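(* For any positive integer $s$ and any nonnegative integer $m$, $$\sum_{\substack{x_1+\dots+x_s=m\\ x_i\ge 0}}\binom{m}{x_1,\dots,x_s}T_{K_{x_1+1}}(x,y)\cdots T_{K_{x_s+1}}(x,y)=\sum_{\pi\in\mathrm{PF}(m,m+s-1)}x^{\mathrm{cm}(\pi)}y^{\mathrm{disp}(\pi)}.$$
   Context: $T_{K_N}(x,y)$ denotes the Tutte polynomial of the complete graph on $N$ vertices ($T_{K_1}=1$). For $0\le m\le n$, $\mathrm{PF}(m,n)$ is the set of sequences $\pi=(\pi_1,\dots,\pi_m)\in\{1,\dots,n\}^m$ such that, when spots $1,\dots,n$ are initially empty and for $i=1,\dots,m$ in turn car $i$ parks in the first empty spot among $\pi_i,\pi_i+1,\dots,n$, every car parks; let $\mathcal O(\pi)_i$ be the spot where car $i$ parks. The displacement is $\mathrm{disp}(\pi)=\sum_{i=1}^m(\mathcal O(\pi)_i-\pi_i)$. For a classical parking function $\tau\in\mathrm{PF}(\ell,\ell)$, an index $i$ is a critical left-to-right maximum if $\tau_s<\tau_i$ for all $s<i$ and there are exactly $\tau_i-1$ entries of $\tau$ less than $\tau_i$ and exactly $\ell-\tau_i$ entries greater than $\tau_i$; $\mathrm{cm}(\tau)$ is the number of such indices. For $\pi\in\mathrm{PF}(m,n)$, let $0=:k_0<k_1<\dots<k_{n-m}<k_{n-m+1}:=n+1$ where $k_1,\dots,k_{n-m}$ are the spots left empty. For each $0\le i\le n-m$, the subsequence of entries of $\pi$ lying strictly between $k_i$ and $k_{i+1}$ (in their original order),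 each decreased by $k_i$, is a classical parking function $\pi'_i\in\mathrm{PF}(k_{i+1}-k_i-1,k_{i+1}-k_i-1)$ (possibly empty, with $\mathrm{cm}=0$). Then $\mathrm{cm}(\pi)=\sum_{i=0}^{n-m}\mathrm{cm}(\pi'_i)$. *)

(* Defs.v *)
From mathcomp Require Export all_boot all_order all_algebra.
From mathcomp Require Export mpoly.

Set Implicit Arguments.
Unset Strict Implicit.
Unset Printing Implicit Defensive.

Import GRing.Theory.
Local Open Scope ring_scope.

(* A simple graph on the vertex type T is given by its edge set
   E : {set {set T}}, a set of 2-element subsets of T. *)

Definition adj (T : finType) (A : {set {set T}}) : rel T :=
  [rel u v | [set u; v] \in A].

Definition rank_edges (T : finType) (A : {set {set T}}) : nat :=
  #|T| - n_comp (adj A) T.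

(* Whitney's rank-nullity expansion; the variables x and y are 'X_0 and 'X_1.
   Both exponents are true (untruncated) differences for A \subset E. *)
Definition tutte (T : finType) (E : {set {set T}}) : {mpoly int[2]} :=
  \sum_(A in powerset E)
     ('X_0 - 1) ^+ (rank_edges E - rank_edges A)
   * ('X_1 - 1) ^+ (#|A| - rank_edges A).

Definition complete_edges (N : nat) : {set {set 'I_N}} :=
  [set e : {set 'I_N} | #|e| == 2].

Definition tutte_complete (N : nat) : {mpoly int[2]} :=
  tutte (complete_edges N).

Definition multinomial (s m : nat) (x : 'I_s -> nat) : nat :=
  (m`! %/ \prod_(i < s) (x i)`!)%N.

(* Cars, preferences and spots: spots are the numbers 1, ..., n, and a
   preference sequence is a seq nat (car i of the mathematics has index i - 1). *)

Definition first_free (n : nat) (occ : seq nat) (a : nat) : option nat :=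
  ohead [seq j <- index_iota a n.+1 | j \notin occ].

(* The spots taken by successive cars with preferences p when the spots in occ
   are already taken; None when some car fails to park. *)
Fixpoint park (n : nat) (occ p : seq nat) : option (seq nat) :=
  if p is a :: p' then
    if first_free n occ a is Some j then omap (cons j) (park n (j :: occ) p')
    else None
  else Some [::].

Definition parking (n : nat) (p : seq nat) : bool :=
  all (fun a => 1 <= a <= n)%N p && isSome (park n [::] p).

(* Meaningful only when parking n p. *)
Definition outcome (n : nat) (p : seq nat) : seq nat := odflt [::] (park n [::] p).

Definition disp (n : nat) (p : seq nat) : nat :=
  (\sum_(i < size p) (nth 0 (outcome n p) i - nth 0 p i))%N.

Definition critical_lr_max (t : seq nat) (i : nat) : bool :=
  let a := nth 0%N t i in
  [&& all (fun b => b < a)%N (take i t),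
      count (fun b => b < a)%N t == (a - 1)%N
    & count (fun b => a < b)%N t == (size t - a)%N].

Definition cm_classical (t : seq nat) : nat :=
  count (critical_lr_max t) (iota 0 (size t)).

(* k_0 = 0 < k_1 < ... < k_(n-m) < k_(n-m+1) = n + 1 *)
Definition walls (n : nat) (p : seq nat) : seq nat :=
  0%N :: rcons [seq j <- iota 1 n | j \notin outcome n p] n.+1.

Definition block (n : nat) (p : seq nat) (i : nat) : seq nat :=
  let k := nth 0%N (walls n p) in
  [seq (a - k i)%N | a <- p & (k i < a < k i.+1)%N].

Definition cm (n : nat) (p : seq nat) : nat :=
  (\sum_(i < (n - size p).+1) cm_classical (block n p i))%N.

(* PF(m, n); values in 'I_n.+1 are 0, ..., n, and parking excludes 0. *)
Definition PF (m n : nat) : {set m.-tuple 'I_n.+1} :=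
  [set p : m.-tuple 'I_n.+1 | parking n (map val p)].

(* Main.v *)
(* Let P_m(x, y) be the sum of x^cm y^disp over PF(m, m), and y = 1 + z.

   A parking function is cut at its first empty spot: the cars preferring an earlier spot form a
   classical parking function, and a word is determined by the shuffle of its small and its large
   letters. Cutting PF(m, m + s) gives a recursion in s that the multinomial sum shares, so only
   T_(K_(m+1)) = P_m remains.

   Cutting an arbitrary word on the letters 1, ..., n + 1, where a letter a <= n weighs z y^(n-a)
   and the letter n + 1 weighs 1, gives
     sum_k C(n, k) z^k P_k(1, y) y^C(n-k, 2) = y^C(n+1, 2).
   Splitting the graphs on n + 1 vertices according to the component of a fixed vertex gives the
   same recursion for the enumerator of connected graphs, which is therefore z^n P_n(1, y).

   Finally, the entries before and after a critical left-to-right maximum a (below and above a in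
   value) are independent classical parking functions, and the later critical maxima are those of
   the second one. Expanding x^cm - 1 over the critical maxima yields
     P_m(x) = P_m(1) + (x - 1) sum_(i < m) C(m, i) P_i(1) P_(m-1-i)(x),
   which is also the recursion for T_(K_(m+1)) by the component of a fixed vertex. *)
Require Import Defs.
From mathcomp Require Import mpoly zify ring.

Set Implicit Arguments.
Unset Strict Implicit.
Unset Printing Implicit Defensive.

Import GRing.Theory.
Local Open Scope ring_scope.

(** * Sums over words *)

Definition below (k : nat) (p : seq nat) : seq nat := [seq a <- p | (a < k)%N].

Definition above (k : nat) (p : seq nat) : seq nat :=
  [seq (a - k)%N | a <- p & (k < a)%N].

Definition letters (N : nat) (p : seq nat) : bool :=
  all (fun a => 1 <= a <= N)%N p.

Section WordSums.

Variable R : comNzRingType.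
Implicit Types (m n N k r : nat) (p u v : seq nat).

(** The words of length [m] on the letters 1, ..., [N], generated letter by letter so that
    inductions can split off the first letter; [a.+1] because ordinals start at 0. *)
Fixpoint wsum m N (f : seq nat -> R) : R :=
  if m is m'.+1 then \sum_(a < N) wsum m' N (fun p => f (a.+1 :: p)) else f [::].

Lemma eq_wsum m N f g :
    (forall p, size p = m -> letters N p -> f p = g p) ->
  wsum m N f = wsum m N g.
Proof.
elim: m f g => [|m IHm] f g efg /=; first exact: efg.
apply: eq_bigr => a _; apply: IHm => p sp lp.
by apply: efg => /=; [rewrite sp | rewrite ltn_ord].
Qed.

Lemma wsum_sum m N (I : Type) (s : seq I) (P : pred I) (F : I -> seq nat -> R) :
  wsum m N (fun p => \sum_(i <- s | P i) F i p)
  = \sum_(i <- s | P i) wsum m N (F i).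
Proof.
elim: m F => [|m IHm] F //=.
by rewrite exchange_big /=; apply: eq_bigr => a _; rewrite IHm.
Qed.

Lemma wsumZ m N c f : wsum m N (fun p => c * f p) = c * wsum m N f.
Proof.
elim: m f => [|m IHm] f //=; rewrite mulr_sumr.
by apply: eq_bigr => a _; rewrite IHm.
Qed.

Lemma wsumZr m N c f : wsum m N (fun p => f p * c) = wsum m N f * c.
Proof. by rewrite mulrC -wsumZ; apply: eq_wsum => p _ _; rewrite mulrC. Qed.

Lemma wsumD m N f g : wsum m N (fun p => f p + g p) = wsum m N f + wsum m N g.
Proof.
elim: m f g => [|m IHm] f g //=; rewrite -big_split.
by apply: eq_bigr => a _; rewrite IHm.
Qed.

Lemma wsum0 m N : wsum m N (fun=> 0) = 0.
Proof. by elim: m => [|m IHm] //=; rewrite big1. Qed.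

Lemma wsum_prod m N (w : nat -> R) :
  wsum m N (fun p => \prod_(a <- p) w a) = (\sum_(a < N) w a.+1) ^+ m.
Proof.
elim: m => [|m IHm] /=; first by rewrite big_nil expr0.
rewrite exprS mulr_suml; apply: eq_bigr => a _.
rewrite -IHm -wsumZ; apply: eq_wsum => p _ _.
by rewrite big_cons.
Qed.

(** Links these sums with the tuples behind [PF], whose entries may also be 0; the hypothesis
    discards the words containing 0. *)
Lemma wsum_tuple m N (G : seq nat -> R) :
    (forall p, 0%N \in p -> G p = 0) ->
  \sum_(t : m.-tuple 'I_N.+1) G (map val t) = wsum m N G.
Proof.
elim: m G => [|m IHm] G G0.
  rewrite (big_pred1 [tuple]) //= => t; apply/esym/eqP; exact: tuple0.
rewrite (reindex (fun x : 'I_N.+1 * m.-tuple 'I_N.+1 => [tuple of x.1 :: x.2])) /=;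
  last first.
  exists (fun t : m.+1.-tuple _ => (thead t, [tuple of behead t])).
    by case=> a t _ /=; congr (_, _); apply: val_inj.
  by move=> t _; rewrite [RHS]tuple_eta.
rewrite -(pair_bigA _ (fun a (t : m.-tuple _) => G (map val (a :: t)))) /=.
rewrite big_ord_recl big1 ?add0r => [|t _]; last by rewrite G0 ?mem_head.
apply: eq_bigr => a _; rewrite -IHm /= ?lift0 // => p p0.
by rewrite G0 // inE p0 orbT.
Qed.

Definition shuffle m k r (F : seq nat -> seq nat -> R) : R :=
  \sum_(i < m.+1) wsum i k (fun u => wsum (m - i) r (F u)) *+ 'C(m, i).

Lemma wsumS m N f :
  wsum m.+1 N f = \sum_(a < N) wsum m N (fun p => f (a.+1 :: p)).
Proof. by []. Qed.

(** Pascal's rule, according to whether the first letter is small or large. *)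
Lemma shuffleS m k r F :
  shuffle m.+1 k r F
  = \sum_(a < k) shuffle m k r (fun u => F (a.+1 :: u))
    + \sum_(a < r) shuffle m k r (fun u v => F u (a.+1 :: v)).
Proof.
rewrite /shuffle [X in _ = X + _]exchange_big [X in _ = _ + X]exchange_big /=.
set T := fun i j => wsum i k (fun u => wsum j r (F u)).
have -> : \sum_(i < m.+1) \sum_(a < k)
    wsum i k (fun u => wsum (m - i) r (F (a.+1 :: u))) *+ 'C(m, i)
    = \sum_(i < m.+1) T i.+1 (m - i)%N *+ 'C(m, i).
  by apply: eq_bigr => i _; rewrite sumrMnl.
have -> : \sum_(i < m.+1) \sum_(a < r)
    wsum i k (fun u => wsum (m - i) r (fun v => F u (a.+1 :: v))) *+ 'C(m, i)
    = \sum_(i < m.+1) T i (m.+1 - i)%N *+ 'C(m, i).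
  apply: eq_bigr => i _; rewrite sumrMnl -wsum_sum; congr (_ *+ _).
  by apply: eq_wsum => u _ _; rewrite subSn // -ltnS.
rewrite -[LHS]/(\sum_(i < m.+2) T i (m.+1 - i)%N *+ 'C(m.+1, i)); clearbody T.
rewrite big_ord_recl [X in _ = _ + X]big_ord_recl [RHS]addrCA; congr (_ + _).
  by rewrite !bin0.
transitivity (\sum_(i < m.+1) (T i.+1 (m - i)%N *+ 'C(m, i)
                               + T i.+1 (m - i)%N *+ 'C(m, i.+1))).
  by apply: eq_bigr => i _; rewrite lift0 binS mulrnDr subSS addrC.
rewrite big_split /=; congr (_ + _).
rewrite big_ord_recr /= bin_small // mulr0n addr0.
by apply: eq_bigr => i _; rewrite /bump leq0n add1n subSS.
Qed.

(* A word avoiding the letter [k + 1] is a shuffle of its small and its large letters. *)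
Lemma wsum_shuffle m k r (F : seq nat -> seq nat -> R) :
  wsum m (k + r.+1) (fun p =>
    if k.+1 \in p then 0 else F (below k.+1 p) (above k.+1 p))
  = shuffle m k r F.
Proof.
elim: m F => [|m IHm] F.
  by rewrite /shuffle big_ord_recl big_ord0 /= mulr1n addr0.
rewrite wsumS big_split_ord big_ord_recl /= shuffleS; congr (_ + _).
  apply: eq_bigr => a _; rewrite -IHm; apply: eq_wsum => p _ _.
  have ak := ltn_ord a.
  rewrite inE eqSS gtn_eqF //= /below /above /= ltnS ak.
  by rewrite [(_ < a.+1)%N]ltnNge ltnS ltnW.
rewrite addn0 (@eq_wsum _ _ _ (fun=> 0)) ?wsum0 ?add0r => [|p _ _]; last first.
  by rewrite inE eqxx.
apply: eq_bigr => a _; rewrite -IHm; apply: eq_wsum => p _ _.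
have -> : (k + bump 0 a)%N = (k + a).+1 by rewrite /bump; lia.
rewrite inE ltn_eqF ?ltnS ?ltn_addr ?leq_addr // /below /above /=.
have -> : ((k + a).+1 < k)%N = false by lia.
have -> : (k.+1 < (k + a).+2)%N by lia.
by rewrite /= !subSS subSn ?leq_addr // addKn.
Qed.

(* The first letter of [p] that is at least [k] is [k], and [k] does not occur again. *)
Fixpoint marked k p : bool :=
  if p is a :: p' then
    if (a < k)%N then marked k p' else (a == k) && (k \notin p')
  else false.

(** Once the [i] places of the small letters are chosen among all [m], the first of the other places
    must carry [k + 1] and the remaining [m - 1 - i] carry large letters. *)
Lemma wsum_marked m k r (F : seq nat -> seq nat -> R) :
  wsum m (k + r.+1) (fun p =>
    if marked k.+1 p then F (below k.+1 p) (above k.+1 p) else 0)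
  = \sum_(i < m) wsum i k (fun u => wsum (m.-1 - i) r (F u)) *+ 'C(m, i).
Proof.
elim: m F => [|m IHm] F; first by rewrite big_ord0.
set T := fun i j => wsum i k (fun u => wsum j r (F u)).
rewrite wsumS big_split_ord big_ord_recl /= addn0.
rewrite [X in _ + (_ + X)]big1 ?addr0 => [|a _]; last first.
  rewrite -[RHS](wsum0 m (k + r.+1)); apply: eq_wsum => p _ _.
  by rewrite /bump !ifF //; lia.
(* If the first letter is [k + 1], the rest only has to avoid [k + 1], which gives a full
   shuffle. *)
have -> : wsum m (k + r.+1) (fun p =>
     if (if (k.+1 < k.+1)%N then marked k.+1 p else (k.+1 == k.+1) && (k.+1 \notin p))
     then F (below k.+1 (k.+1 :: p)) (above k.+1 (k.+1 :: p)) else 0)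
   = \sum_(i < m.+1) T i (m - i)%N *+ 'C(m, i).
  rewrite -[RHS]/(shuffle m k r F) -wsum_shuffle; apply: eq_wsum => p _ _.
  by rewrite ltnn eqxx /below /above /= ltnn; case: (k.+1 \in p).
have -> : \sum_(a < k) wsum m (k + r.+1) (fun p =>
     if (if (a.+1 < k.+1)%N then marked k.+1 p else (a.+1 == k.+1) && (k.+1 \notin p))
     then F (below k.+1 (a.+1 :: p)) (above k.+1 (a.+1 :: p)) else 0)
   = \sum_(i < m) T i.+1 (m.-1 - i)%N *+ 'C(m, i).
  transitivity (\sum_(a < k) \sum_(i < m)
      wsum i k (fun u => wsum (m.-1 - i) r (F (a.+1 :: u))) *+ 'C(m, i)).
    apply: eq_bigr => a _; rewrite -IHm; apply: eq_wsum => p _ _.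
    have ak := ltn_ord a.
    rewrite ltnS ak /below /above /= ltnS ak.
    by rewrite [(_ < a.+1)%N]ltnNge ltnS ltnW.
  by rewrite exchange_big; apply: eq_bigr => i _; rewrite sumrMnl.
rewrite -[RHS]/(\sum_(i < m.+1) T i (m - i)%N *+ 'C(m.+1, i)); clearbody T.
rewrite big_ord_recl [RHS]big_ord_recl addrCA !bin0; congr (_ + _).
rewrite -big_split /=; apply: eq_bigr => i _.
rewrite /bump leq0n add1n binS mulrnDr addrC; congr (_ + T _ _ *+ _); lia.
Qed.

End WordSums.

(** * The parking process *)

Section Parking.

Local Open Scope nat_scope.

Implicit Types (n k a j t : nat) (occ p q : seq nat).

Lemma first_freeP n occ a j :
  first_free n occ a = Some j <->
  [/\ a <= j <= n, j \notin occ & forall i, a <= i < j -> i \in occ].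
Proof.
rewrite /first_free /index_iota.
suff H l : ohead [seq j <- iota a l | j \notin occ] = Some j <->
    [/\ a <= j < a + l, j \notin occ & forall i, a <= i < j -> i \in occ].
  rewrite H; have -> // : (a <= j < a + (n.+1 - a)) = (a <= j <= n) by lia.
elim: l a => [|l IHl] a /=; first by split=> [|[aj _ _]] //; lia.
have [aocc|naocc] /= := boolP (a \in occ); last first.
  split=> [[<-]|[aj jocc aji]].
    by split=> // [|i]; lia.
  have [->//|ne] := eqVneq a j.
  by case/negP: naocc; apply: aji; lia.
rewrite IHl; split=> -[aj jocc aji]; split=> //; first by lia.
- move=> i ai; have [->//|ne] := eqVneq i a.
  by apply: aji; lia.
- by have : a != j by [apply: contraNneq jocc => <-]; lia.
- by move=> i ai; apply: aji; lia.
Qed.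

Lemma first_free_None n occ a :
  first_free n occ a = None <-> forall i, a <= i <= n -> i \in occ.
Proof.
rewrite /first_free /index_iota; split.
  move=> H i ai; apply/negPn/negP => iocc.
  suff : i \in [seq j <- iota a (n.+1 - a) | j \notin occ].
    by case: filter H.
  by rewrite mem_filter iocc mem_iota; lia.
move=> H; rewrite (@eq_in_filter _ _ pred0) ?filter_pred0 // => i.
by rewrite mem_iota => ai; apply/negbTE/negPn/H; lia.
Qed.

Lemma park_size n occ p q : park n occ p = Some q -> size q = size p.
Proof.
elim: p occ q => [|a p IHp] occ q /=; first by case=> <-.
case: first_free => // j; case E: park => [q'|] //= [<-].
by rewrite /= (IHp _ _ E).
Qed.

Lemma park_uniq n occ p q : park n occ p = Some q -> uniq q /\ {in q, forall j, j \notin occ}.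
Proof.
elim: p occ q => [|a p IHp] occ q /=; first by case=> <-.
case E1: first_free => [j|//]; case E: park => [q'|] //= [<-].
have [uq nq] := IHp _ _ E; have [_ jocc _] := (first_freeP _ _ _ _).1 E1.
split=> [|i]; first by rewrite /= uq andbT; apply/negP => /nq; rewrite inE eqxx.
rewrite inE => /predU1P[->//|/nq]; by rewrite inE negb_or => /andP[].
Qed.

Lemma park_le n occ p q :
  park n occ p = Some q -> all2 (fun a j => a <= j <= n) p q.
Proof.
elim: p occ q => [|a p IHp] occ q /=; first by case=> <-.
case E1: first_free => [j|//]; case E: park => [q'|] //= [<-].
have [aj _ _] := (first_freeP _ _ _ _).1 E1.
by rewrite aj (IHp _ _ E).
Qed.

Lemma park_letters n occ p q :
  letters n p -> park n occ p = Some q -> letters n q.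
Proof.
move=> + /park_le; elim: p q => [|a p IHp] [|j q] //= /andP[an lp] /andP[aj pq].
by rewrite IHp // andbT; lia.
Qed.

Lemma dispE n p q :
  park n [::] p = Some q -> disp n p + sumn p = sumn q.
Proof.
move=> E; rewrite /disp /outcome E /=; move/park_le: E.
elim: p q => [|a p IHp] [|j q] //=; first by rewrite big_ord0.
move=> /andP[aj pq]; rewrite big_ord_recl /= -(IHp _ pq).
have -> : \sum_(i < size p) (nth 0 (j :: q) (bump 0 i) - nth 0 (a :: p) (bump 0 i))
   = \sum_(i < size p) (nth 0 q i - nth 0 p i) by [].
lia.
Qed.

Lemma parkingE n p : letters n p -> parking n p = isSome (park n [::] p).
Proof. by rewrite /parking => lp; rewrite [X in X && _]lp. Qed.

(** No car drives past a spot that stays empty, so every car parks on the side of [t] that it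
    prefers. *)
Lemma park_gt n occ p q t :
    park n occ p = Some q -> t \notin occ -> t \notin q ->
  count (fun a => t < a) q = count (fun a => t < a) p.
Proof.
elim: p occ q => [|a p IHp] occ q /=; first by case=> <-.
case E1: first_free => [j|//]; case E: park => [q'|] //= [<-].
have [aj jocc aji] := (first_freeP _ _ _ _).1 E1.
move=> tocc; rewrite inE negb_or => /andP[tj tq'].
congr (_ + _); last by apply: IHp E _ _; rewrite // inE negb_or tj.
suff -> : (t < j) = (t < a) by [].
have : ~~ (a <= t < j) by apply: contra tocc => /aji.
lia.
Qed.

Lemma park_rcons n occ p a :
  park n occ (rcons p a) =
  if park n occ p is Some q then
    omap (rcons q) (first_free n (catrev q occ) a)
  else None.
Proof.
elim: p occ => [|b p IHp] occ /=; first by case: first_free.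
case: (first_free n occ b) => // j; rewrite IHp.
by case: park => //= q; case: first_free.
Qed.

Lemma count_uniq_le (P : pred nat) q p :
  uniq q -> {subset filter P q <= p} -> count P q <= size p.
Proof. by move=> uq sub; rewrite -size_filter uniq_leq_size ?filter_uniq. Qed.

Lemma park_count_gt n p q t :
  park n [::] p = Some q -> count (fun a => t < a) p <= n - t.
Proof.
move=> E; have [uq _] := park_uniq E; have le := park_le E.
apply: (@leq_trans (count (fun a => t < a) q)).
  elim: p q {E uq} le => [|a p IHp] [|j q] //= /andP[aj /IHp]; lia.
rewrite -[n - t](size_iota t.+1) count_uniq_le // => j.
rewrite mem_filter mem_iota => /andP[tj jq].
suff : j <= n by lia.
elim: p q {E uq} le jq => [|a p IHp] [|i q] //= /andP[aj /IHp{}IHp].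
by rewrite inE => /predU1P[->|/IHp//]; lia.
Qed.

(** If the last car failed, let [t] be the largest empty spot before its preference. The [n - t]
    spots beyond [t] are then taken by cars preferring spots beyond [t], and the last car is one too
    many. *)
Lemma park_exists n p :
    letters n p -> (forall t, t < n -> count (fun a => t < a) p <= n - t) ->
    size p <= n ->
  isSome (park n [::] p).
Proof.
elim/last_ind: p => [//|p a IHp] lpa cpa spa.
have : letters n p by move: lpa; rewrite /letters all_rcons => /andP[].
move=> lp; have : isSome (park n [::] p).
  apply: IHp => // [t /cpa|]; last by move: spa; rewrite size_rcons => /ltnW.
  rewrite -cats1 count_cat; lia.
rewrite park_rcons; case E: park => [q|//] _.
case E1: first_free => [//|] /=; move/first_free_None: E1 => full.
have {full} full i : a <= i <= n -> i \in q.
  by move=> /full; rewrite catrevE cats0 mem_rev.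
have lq := park_letters lp E; have [uq _] := park_uniq E.
have an : 1 <= a <= n by move: lpa; rewrite /letters all_rcons => /andP[].
(* The search downwards from [a] stops at 0 at the latest, since 0 is never taken. *)
have [t [ta tq tfull]] : exists t, [/\ t < a, t \notin q & forall i, t < i <= n -> i \in q].
  have q0 : 0 \notin q by apply/negP => /(allP lq).
  move=> {lpa cpa spa E}; elim: a an full => [//|a IHa] an full.
  have [aq|naq] := boolP (a \in q); last by exists a; split=> // i; apply: full.
  have [||t [ta tq H]] := IHa; last by exists t; split=> //; lia.
    by have : a != 0 by [apply: contraTneq aq => ->]; lia.
  by move=> i ai; have [<-//|ne] := eqVneq a i; apply: full; lia.
have := cpa t; rewrite -cats1 count_cat /= ta -(park_gt E) //.
suff : n - t <= count (fun a => t < a) q by lia.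
rewrite -size_filter -[n - t](size_iota t.+1); apply: uniq_leq_size; first exact: iota_uniq.
by move=> i; rewrite mem_iota mem_filter => ti; rewrite tfull; lia.
Qed.

End Parking.

(** * Splitting at the first empty spot *)

Section Split.

Local Open Scope nat_scope.

Implicit Types (n k a j t m : nat) (occ p q : seq nat).

Lemma mem_below j k p : (j \in below k p) = (j < k) && (j \in p).
Proof. by rewrite mem_filter. Qed.

Lemma mem_above j k p : 0 < j -> (j \in above k p) = (k + j \in p).
Proof.
move=> j0; apply/mapP/idP => [[a]|jp].
  by rewrite mem_filter => /andP[ka ap] ->; rewrite subnKC // ltnW.
by exists (k + j); rewrite ?addKn // mem_filter jp; lia.
Qed.

Lemma first_free_below n k occ a j :
    a <= k -> k < n -> first_free k (below k.+1 occ) a = Some j ->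
  first_free n occ a = Some j /\ j <= k.
Proof.
move=> ak kn /first_freeP[aj jocc aji]; split; last by lia.
apply/first_freeP; split; first by lia.
  by move: jocc; rewrite mem_below negb_and => /orP[|//]; lia.
by move=> i /aji; rewrite mem_below => /andP[].
Qed.

Lemma first_free_above n k occ a :
    k < a -> k < n ->
  first_free n occ a
  = omap (addn k) (first_free (n - k) (above k occ) (a - k)).
Proof.
move=> ka kn; case E: (first_free (n - k)) => [j|] /=; last first.
  apply/first_free_None => i ai; move/first_free_None: E => /(_ (i - k)).
  by rewrite mem_above ?subnKC; [apply|..]; lia.
apply/first_freeP; move/first_freeP: E => [aj jocc aji]; split; first by lia.
  by rewrite -mem_above //; lia.
move=> i ai; have := aji (i - k).
by rewrite mem_above ?subnKC; [apply|..]; lia.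
Qed.

Lemma below_cons k a p :
  below k (a :: p) = if a < k then a :: below k p else below k p.
Proof. by []. Qed.

Lemma above_cons k a p :
  above k (a :: p) = if k < a then a - k :: above k p else above k p.
Proof. by rewrite /above /=; case: (k < a). Qed.

(** Cars preferring a spot beyond [k + 1] never look at earlier spots, and by hypothesis the other
    cars find room before [k + 1]. The two processes therefore do not interact, however they are
    interleaved. *)
Lemma park_split n k occ p q1 :
    k < n -> k.+1 \notin occ -> k.+1 \notin p ->
    park k (below k.+1 occ) (below k.+1 p) = Some q1 ->
  if park (n - k.+1) (above k.+1 occ) (above k.+1 p) is Some q2 then
    exists q, [/\ park n occ p = Some q, k.+1 \notin q,
                  below k.+1 q = q1 & above k.+1 q = q2]
  else park n occ p = None.
Proof.
move=> kn; elim: p occ q1 => [|a p IHp] occ q1 kocc.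
  by move=> _ [<-]; exists [::].
rewrite inE negb_or => /andP[ka kp]; rewrite below_cons above_cons.
have kjocc j : j != k.+1 -> k.+1 \notin j :: occ.
  by rewrite inE negb_or kocc andbT eq_sym.
have [ak|ak] := ltnP a k.+1.
  have -> : (k.+1 < a) = false by lia.
  rewrite [park k _ _]/=; case E1: first_free => [j|//].
  case E2: park => [q1'|] //= [<-].
  have [-> jk] := first_free_below (k := k) (n := n) ak kn E1.
  have jk' : j != k.+1 by lia.
  have jk'' : (k.+1 < j) = false by lia.
  have := IHp (j :: occ) q1' (kjocc _ jk') kp.
  rewrite below_cons above_cons ltnS jk jk'' => /(_ E2).
  case: (park (n - _)) => [q2 [q [-> kq bq aq]]|-> //].
  exists (j :: q); rewrite below_cons above_cons ltnS jk jk'' bq.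
  by split=> //; rewrite inE negb_or eq_sym jk'.
have ak' : k.+1 < a by rewrite ltn_neqAle ka.
rewrite ak' => E1 /=.
have [kn'|kn'] := ltnP k.+1 n; last first.
  have -> : first_free (n - k.+1) (above k.+1 occ) (a - k.+1) = None.
    by apply/first_free_None => i; lia.
  by have -> : first_free n occ a = None by apply/first_free_None => i; lia.
rewrite (first_free_above _ ak') //; case E2: first_free => [j|//] /=.
have [aj _ _] := (first_freeP _ _ _ _).1 E2.
have j1 : (k.+1 + j < k.+1) = false by lia.
have j2 : k.+1 < k.+1 + j by lia.
have j3 : k.+1 + j != k.+1 by lia.
have := IHp (k.+1 + j :: occ) q1 (kjocc _ j3) kp.
rewrite below_cons above_cons j1 j2 addKn => /(_ E1).
case: (park (n - _)) => [q2 [q [-> kq bq aq]]|-> //].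
exists (k.+1 + j :: q); rewrite below_cons above_cons j1 j2 addKn aq.
by split=> //; rewrite inE negb_or eq_sym j3.
Qed.

(* Spot [k + 1] is the first one left empty: the cars preferring an earlier spot fill the spots
   [1], ..., [k]. *)
Definition gap k p : bool :=
  [&& k.+1 \notin p, size (below k.+1 p) == k & parking k (below k.+1 p)].

(** For all [t] up to the length, this is the counting criterion for classical parking functions;
    its first failure locates the first empty spot. *)
Definition filled p t : bool := t <= count (fun a => a <= t) p.

Lemma letters_below n k p : letters n p -> letters k (below k.+1 p).
Proof.
move=> lp; apply/allP => a; rewrite mem_below => /andP[ak /(allP lp)]; lia.
Qed.

Lemma letters_above n k p : letters n p -> letters (n - k) (above k p).
Proof.
move=> lp; apply/allP => b /mapP[a]; rewrite mem_filter => /andP[ka /(allP lp) an] ->.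
by lia.
Qed.

Lemma count_le_gt p t :
  count (fun a => a <= t) p + count (fun a => t < a) p = size p.
Proof.
rewrite -(count_predC (fun a => a <= t)); congr (_ + _).
by apply: eq_count => a /=; lia.
Qed.

Lemma parking_filledP n p :
    size p = n -> letters n p ->
  reflect (forall t, t <= n -> filled p t) (parking n p).
Proof.
move=> sp lp; rewrite parkingE //; apply: (iffP idP) => [|H].
  case E: park => [q|//] _ t tp; rewrite /filled.
  by have := park_count_gt t E; have := count_le_gt p t; lia.
apply: park_exists => [|t tp|]; rewrite ?sp //; have := H t (ltnW tp); rewrite /filled.
by have := count_le_gt p t; lia.
Qed.

Lemma size_below k p : size (below k p) = count (fun a => a < k) p.
Proof. exact: size_filter. Qed.

Lemma size_above k p : size (above k p) = count (fun a => k < a) p.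
Proof. by rewrite size_map size_filter. Qed.

Lemma filled_below k p t : t <= k -> filled (below k.+1 p) t = filled p t.
Proof.
move=> tk; rewrite /filled /below count_filter; congr (_ <= _).
by apply: eq_count => a /=; lia.
Qed.

(** At least [k] letters up to [k] and fewer than [k + 1] letters up to [k + 1] leave exactly [k]
    small letters and no letter [k + 1]. *)
Lemma gapE n k p :
    letters n p ->
  gap k p <-> (forall t, t <= k -> filled p t) /\ ~~ filled p k.+1.
Proof.
move=> lp; have lb := letters_below k lp; rewrite /gap.
have cnt : count (fun a => a <= k.+1) p = size (below k.+1 p) + count_mem k.+1 p.
  rewrite size_below; elim: (p) => //= a s ->.
  by have := leq_eqVlt a k.+1; case: eqP; case: ltnP; lia.
split.
  move=> /and3P[kp /eqP sb pb]; split=> [t tk|].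
    by rewrite -(filled_below _ tk); apply: (parking_filledP sb lb pb).
  rewrite /filled cnt sb; rewrite -has_pred1 has_count -eqn0Ngt in kp.
  by rewrite (eqP kp); lia.
move=> [fk nfk]; have := fk k (leqnn k); rewrite /filled -(size_below k.+1) => sk.
move: nfk; rewrite /filled cnt => nfk.
have sb : size (below k.+1 p) = k by lia.
rewrite sb eqxx -has_pred1 has_count -eqn0Ngt /=.
have -> : count_mem k.+1 p == 0 by lia.
apply/(parking_filledP sb lb) => t tk.
by rewrite filled_below // fk.
Qed.

(** Take the first failure of [filled]; it occurs at [size p + 1] at the latest, where there are too
    few letters. *)
Lemma gap_exists n p : letters n p -> exists2 k, k <= size p & gap k p.
Proof.
move=> lp; have ex : exists k, ~~ filled p k.+1.
  by exists (size p); rewrite /filled -ltnNge ltnS count_size.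
exists (ex_minn ex); case: ex_minnP => k nfk kmin.
  by apply: kmin; rewrite /filled -ltnNge ltnS count_size.
apply/(gapE _ lp); split=> // -[//|t tk].
by apply/negPn/negP => /kmin; lia.
Qed.

Lemma gap_unique n p k k' : letters n p -> gap k p -> gap k' p -> k = k'.
Proof.
move=> lp /(gapE _ lp)[f nf] /(gapE _ lp)[f' nf'].
have [kk|kk|//] := ltngtP k k'.
  by rewrite f' in nf.
by rewrite f in nf'.
Qed.

Lemma count_split_mem (P : pred nat) k p :
  k \notin p -> count P p
    = count P (below k p) + count (fun a => P (k + a)) (above k p).
Proof.
rewrite /above count_map !count_filter.
elim: p => //= a p IHp; rewrite inE negb_or => /andP[ka /IHp ->].
case: (ltngtP a k) ka => //= ak _; rewrite ?addn0 ?add0n ?andbT ?andbF ?add0n ?addnA //.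
by rewrite subnKC 1?ltnW //; lia.
Qed.

Lemma sumn_split k p :
  sumn p = sumn (below k p) + k * count_mem k p + (sumn (above k p) + k * size (above k p)).
Proof.
rewrite size_above /above /below; elim: p => [|a p /= ->]; first by rewrite /=; lia.
case: (ltngtP a k) => /= ak; nia.
Qed.

Lemma park_outcome n p : parking n p -> park n [::] p = Some (outcome n p).
Proof. by case/andP=> _; rewrite /outcome; case: park. Qed.

Lemma parking_letters n p : parking n p -> letters n p.
Proof. by case/andP. Qed.

Lemma gap_park n k p :
    k < n -> letters n p -> gap k p ->
  if parking (n - k.+1) (above k.+1 p) then
    [/\ park n [::] p = Some (outcome n p), k.+1 \notin outcome n p,
        below k.+1 (outcome n p) = outcome k (below k.+1 p)
      & above k.+1 (outcome n p) = outcome (n - k.+1) (above k.+1 p)]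
  else park n [::] p = None.
Proof.
move=> kn lp /and3P[kp /eqP sb pb].
rewrite parkingE ?letters_above //.
have := park_split (occ := [::]) kn isT kp (park_outcome pb).
rewrite [outcome (n - _) _]/outcome /outcome.
case: (park (n - _)) => [q2|//] /= [q [-> kq bq aq]] /=.
by split.
Qed.

Lemma parking_gap n k p :
    k < n -> letters n p -> gap k p ->
  parking n p = parking (n - k.+1) (above k.+1 p).
Proof.
move=> kn lp gp; rewrite (parkingE lp); have := gap_park kn lp gp.
by case: ifP => _ => [[->]|->].
Qed.

(** Displacement is the sum of the outcomes minus that of the preferences. Both sums split at
    [k + 1], and the shifts cancel because as many cars park beyond [k + 1] as prefer to. *)
Lemma disp_gap n k p :
    k < n -> parking n p -> gap k p ->
  disp n p = disp k (below k.+1 p) + disp (n - k.+1) (above k.+1 p).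
Proof.
move=> kn pp gp; have lp := parking_letters pp.
have := gap_park kn lp gp; have pa := pp; rewrite (parking_gap kn lp gp) in pa.
rewrite pa => -[E kq bq aq].
have /and3P[kp /eqP sb pb] := gp.
have := dispE E; have := dispE (park_outcome pa); have := dispE (park_outcome pb).
rewrite -bq -aq (sumn_split k.+1 p) (sumn_split k.+1 (outcome n p)).
rewrite aq (park_size (park_outcome pa)) -aq (count_memPn kp) (count_memPn kq).
move: (sumn _) (sumn _) (sumn _) (sumn _) (size _) => ? ? ? ? ?; nia.
Qed.

(** All spots are taken, so the outcomes are a permutation of 1, ..., [size p]. *)
Lemma disp_classical p :
  parking (size p) p -> disp (size p) p + sumn p = 'C((size p).+1, 2).
Proof.
move=> pp; have E := park_outcome pp; rewrite (dispE E).
have [uq _] := park_uniq E; have lq := park_letters (parking_letters pp) E.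
have /perm_sumn-> : perm_eq (outcome (size p) p) (iota 1 (size p)).
  apply: uniq_perm => //; first exact: iota_uniq.
  have := uniq_min_size uq _ _; case/(_ (iota 1 (size p))) => //.
    by move=> i /(allP lq); rewrite mem_iota; lia.
  by rewrite size_iota (park_size E).
by rewrite -triangular_sum /index_iota subn0 /= big_cons sumnE.
Qed.

End Split.

(** * Critical left-to-right maxima *)

Section Maxima.

Local Open Scope nat_scope.

Implicit Types (n k a j t m : nat) (occ p q : seq nat).

Lemma parking_size_le n p : parking n p -> size p <= n.
Proof.
move=> pp; have E := park_outcome pp; have [uq _] := park_uniq E.
have lq := park_letters (parking_letters pp) E.
rewrite -(park_size E); suff : size (outcome n p) <= size (iota 1 n) by rewrite size_iota.
by apply: uniq_leq_size => // i /(allP lq); rewrite mem_iota; lia.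
Qed.

Lemma size_walls n p : parking n p -> size (walls n p) = (n - size p).+2.
Proof.
move=> pp; have E := park_outcome pp; have [uq _] := park_uniq E.
have lq := park_letters (parking_letters pp) E.
rewrite /walls /= size_rcons size_filter -(park_size E).
have := count_predC (mem (outcome n p)) (iota 1 n); rewrite size_iota.
have -> : count (mem (outcome n p)) (iota 1 n) = size (outcome n p).
  rewrite -size_filter; apply: perm_size; apply: uniq_perm => //.
    by rewrite filter_uniq ?iota_uniq.
  move=> i; rewrite mem_filter mem_iota /=; case: (boolP (_ \in _)) => //= /(allP lq).
  by lia.
rewrite (@eq_count _ (predC (mem _)) (fun j => j \notin outcome n p)) // => H.
by rewrite -[X in _ = (X - _).+2]H addKn.
Qed.

Lemma parking_full n p j :
  parking n p -> size p = n -> 1 <= j <= n -> j \in outcome n p.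
Proof.
move=> pp sp jn; have E := park_outcome pp; have [uq _] := park_uniq E.
have lq := park_letters (parking_letters pp) E.
have sub : {subset outcome n p <= iota 1 n}.
  by move=> i /(allP lq); rewrite mem_iota; lia.
have [|_ ->] := uniq_min_size uq sub; last by rewrite mem_iota; lia.
by rewrite size_iota (park_size E) sp.
Qed.

(** The small letters fill the spots 1, ..., [k], and the wall 0 of the shifted word becomes the
    wall [k + 1]. *)
Lemma walls_gap n k p :
    k < n -> parking n p -> gap k p ->
  walls n p = 0 :: map (addn k.+1) (walls (n - k.+1) (above k.+1 p)).
Proof.
move=> kn pp gp; have lp := parking_letters pp; have := gap_park kn lp gp.
rewrite -(parking_gap kn lp gp) pp => -[_ kq bq aq].
rewrite /walls /= map_rcons addn0; congr (_ :: _).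
have -> : k.+1 + (n - k.+1).+1 = n.+1 by lia.
rewrite -rcons_cons; congr rcons.
have -> : iota 1 n = iota 1 k ++ k.+1 :: iota k.+2 (n - k.+1).
  rewrite -[k.+1 :: _]/(iota k.+1 (n - k.+1).+1) -add1n -iotaD; congr iota; lia.
have /and3P[_ /eqP sb pb] := gp.
rewrite filter_cat /= kq (@eq_in_filter _ _ pred0) ?filter_pred0 /=; last first.
  move=> j; rewrite mem_iota => jk; apply/negbTE; rewrite negbK.
  have : j \in below k.+1 (outcome n p) by rewrite bq parking_full //; lia.
  by rewrite mem_below => /andP[].
congr (_ :: _); rewrite -[k.+2]addn1 iotaDl filter_map; congr map.
apply: eq_in_filter => j; rewrite mem_iota => j1 /=.
by rewrite -aq mem_above //; lia.
Qed.

Lemma cm_gap n k p :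
    k < n -> parking n p -> gap k p ->
  cm n p = cm_classical (below k.+1 p) + cm (n - k.+1) (above k.+1 p).
Proof.
move=> kn pp gp; have lp := parking_letters pp.
have pa := pp; rewrite (parking_gap kn lp gp) in pa.
have /and3P[kp /eqP sb pb] := gp.
have sp : size p = k + size (above k.+1 p).
  by rewrite -count_predT (count_split_mem _ kp) count_predT sb -count_predT.
have sa := parking_size_le pa; have sw := size_walls pa.
rewrite /cm; have -> : n - size p = (n - k.+1 - size (above k.+1 p)).+1 by lia.
rewrite big_ord_recl /block (walls_gap kn pp gp); congr (_ + _).
  congr cm_classical; rewrite /= addn0 -[RHS]map_id; rewrite (@eq_map _ _ _ id).
    by congr map; apply: eq_in_filter => a /(allP lp); lia.
  by move=> a; rewrite subn0.
apply: eq_bigr => i _; have ilt := ltn_ord i; congr cm_classical.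
move: (walls _ _) sw => w sw.
have nS s j : nth 0 (0 :: s) j.+1 = nth 0 s j by [].
have nw j : j < size w -> nth 0 (map (addn k.+1) w) j = k.+1 + nth 0 w j.
  by move=> jw; rewrite (nth_map 0).
rewrite lift0 !nS !nw; try lia.
rewrite /above filter_map -map_comp -filter_predI.
rewrite [LHS](@eq_map _ _ _ (fun a => a - k.+1 - nth 0 w i)); last by move=> a; rewrite subnDA.
by congr map; apply: eq_in_filter => a _ /=; lia.
Qed.

Lemma cm_full n p : size p = n -> parking n p -> cm n p = cm_classical p.
Proof.
move=> sp pp; have W : walls n p = [:: 0; n.+1].
  have := size_walls pp; rewrite sp subnn /walls.
  by case: [seq j <- iota 1 n | _] => [|? [|? ?]].
rewrite /cm /block sp subnn big_ord_recl big_ord0 addn0 W /=; congr cm_classical.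
rewrite -[RHS]map_id; rewrite (@eq_map _ _ _ id); last by move=> a; rewrite subn0.
congr map; apply/all_filterP; move: (parking_letters pp).
by apply: sub_all => a /=; lia.
Qed.

(** Left-to-right maxima are recorded by value instead of position; the position is the first
    occurrence of the value. *)
Definition lr_max k p : bool := ohead [seq a <- p | k <= a] == Some k.

Local Arguments lr_max : simpl never.

Lemma lr_max_cons k a p : lr_max k (a :: p) = if a < k then lr_max k p else a == k.
Proof. by rewrite /lr_max /= ltnNge; case: leqP. Qed.

Lemma markedE k p : marked k p = lr_max k p && (count_mem k p == 1).
Proof.
elim: p => [|a p IHp]; first by rewrite andbF.
rewrite lr_max_cons /= IHp; case: (ltngtP a k) => //= _.
by rewrite -has_pred1 has_count -eqn0Ngt.
Qed.

(** The arbitrary predicate [D] carries the induction: behind a first letter [a], the maxima of the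
    tail count only if they exceed [a], and this condition is absorbed into [D]. *)
Lemma count_lr_max N p (D : pred nat) :
    letters N p ->
  count (fun i => all (fun b => b < nth 0 p i) (take i p) && D (nth 0 p i))
    (iota 0 (size p))
  = count (fun k => lr_max k p && D k) (iota 1 N).
Proof.
elim: p D => [|a p IHp] D /=.
  by rewrite (@eq_count _ _ pred0) ?count_pred0.
case/andP => aN lp; rewrite -[1]addn0 iotaDl count_map.
have := IHp (fun k => (a < k) && D k) lp.
under eq_count => i do rewrite andbCA andbA.
rewrite [X in _ + X](@eq_count _ _ (fun i =>
  (a < nth 0 p i) && all (fun b => b < nth 0 p i) (take i p) && D (nth 0 p i))) //.
move=> ->; rewrite [RHS](@eq_count _ _ (predU (fun k => (k == a) && D a)
  (fun k => lr_max k p && ((a < k) && D k)))); last first.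
  move=> k; rewrite lr_max_cons /=; case: (ltngtP a k) => //= [_|->].
    by rewrite andbF.
  by rewrite andbF orbF.
have := count_predUI (fun k => (k == a) && D a)
  (fun k => lr_max k p && ((a < k) && D k)) (iota 1 N).
rewrite [X in _ + X](@eq_count _ _ pred0); last first.
  by move=> k /=; case: eqP => // ->; rewrite ltnn !andbF.
rewrite count_pred0 addn0 => ->; congr (_ + _).
case: (D a); last by rewrite (@eq_count _ _ pred0) ?count_pred0 // => k; rewrite andbF.
rewrite (@eq_count _ _ (pred1 a)) => [|k]; last by rewrite andbT.
rewrite count_uniq_mem ?iota_uniq // mem_iota; lia.
Qed.

Definition critical n k p : bool :=
  [&& lr_max k p, count (fun b => b < k) p == k - 1
    & count (fun b => k < b) p == n - k].

Lemma cm_classicalE n p :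
    size p = n -> letters n p ->
  cm_classical p = count (fun k => critical n k p) (iota 1 n).
Proof.
move=> <- lp.
exact: (@count_lr_max _ _ (fun k => (count (fun b => b < k) p == k - 1)
    && (count (fun b => k < b) p == size p - k)) lp).
Qed.

(** The letters below, equal to and above [k + 1] number [n] in all; with [k] below, having
    [n - k - 1] above means that [k + 1] occurs once. *)
Lemma criticalE n k p :
    size p = n -> k < n ->
  critical n k.+1 p = marked k.+1 p && (size (below k.+1 p) == k).
Proof.
move=> sp kn; rewrite /critical markedE size_below subn1 /=.
have : count (fun b => b < k.+1) p + count_mem k.+1 p + count (fun b => k.+1 < b) p = n.
  rewrite -sp; elim: p {sp} => //= a p <-; case: (ltngtP a k.+1); lia.
case: lr_max => //=; lia.
Qed.

Lemma count_above k (P : pred nat) p :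
  count P (above k p) = count (fun a => (k < a) && P (a - k)) p.
Proof. by rewrite /above count_map count_filter; apply: eq_count => a /=; rewrite andbC. Qed.

Lemma count_shift (P Q : pred nat) k p :
    (forall a, P a = (a <= k) || Q (a - k)) ->
  count P p = count (fun a => a <= k) p + count Q (above k p).
Proof.
move=> PQ; rewrite count_above; elim: p => //= a p ->; rewrite PQ.
by case: (leqP a k) => /=; lia.
Qed.

Section Marked.

Variables (n k : nat) (p : seq nat).
Hypotheses (kn : k < n) (sp : size p = n) (lp : letters n p).
Hypotheses (mp : marked k.+1 p) (sb : size (below k.+1 p) = k).

Lemma count_le_marked : count (fun a => a <= k.+1) p = k.+1.
Proof.
move: mp; rewrite markedE => /andP[_ /eqP c1].
rewrite -[RHS]addn1 -{2}sb size_below -c1; elim: (p) => //= a s ->.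
by case: (ltngtP a k.+1); lia.
Qed.

Lemma size_above_marked : size (above k.+1 p) = n - k.+1.
Proof.
rewrite size_above; have := count_le_gt p k.+1; rewrite count_le_marked; lia.
Qed.

(** Up to [k] the counting criterion sees only the small letters. As exactly [k + 1] letters are at
    most [k + 1], from there on it is the criterion for the shifted large letters. *)
Lemma parking_marked :
  parking n p = parking k (below k.+1 p) && parking (n - k.+1) (above k.+1 p).
Proof.
have lb := letters_below k lp; have la := letters_above k.+1 lp.
have fa j : filled p (k.+1 + j) = filled (above k.+1 p) j.
  rewrite /filled (@count_shift _ (fun a => a <= j) k.+1); last by move=> a; lia.
  by rewrite count_le_marked leq_add2l.
apply/(parking_filledP sp lp)/andP => [H|].
  split; first by apply/(parking_filledP sb lb) => t tk; rewrite filled_below // H; lia.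
  apply/(parking_filledP size_above_marked la) => t tk; rewrite -fa H; lia.
move=> [/(parking_filledP sb lb) Hb /(parking_filledP size_above_marked la) Ha] t tn.
have [tk|kt] := leqP t k; first by rewrite -(filled_below _ tk) Hb.
by rewrite -(subnKC kt) fa Ha //; lia.
Qed.

(** By [disp_classical] each displacement is a triangular number minus the sum of the word, so only
    sums have to be compared. *)
Lemma disp_marked :
    parking n p ->
  disp n p = disp k (below k.+1 p) + disp (n - k.+1) (above k.+1 p).
Proof.
move=> pp; have := pp; rewrite parking_marked => /andP[].
move: (pp); rewrite -{1}sb -size_above_marked -{1}sp.
move=> /disp_classical d1 /disp_classical d2 /disp_classical.
rewrite size_above_marked; move: d1 d2; rewrite sb sp.
have := sumn_split k.+1 p; rewrite size_above_marked.
have -> : count_mem k.+1 p = 1 by move: mp; rewrite markedE => /andP[_ /eqP].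
have C2 j : 'C(j.+1, 2) * 2 = j.+1 * j by rewrite -[2 in LHS]/(2`!) bin_ffact ffactnS ffactn1.
have := C2 n; have := C2 k; have := C2 (n - k.+1).
nia.
Qed.

Lemma critical_above j :
  0 < j -> critical n (k.+1 + j) p = critical (n - k.+1) j (above k.+1 p).
Proof.
move=> j0; rewrite /critical /lr_max.
have -> : [seq a <- p | k.+1 + j <= a] = [seq k.+1 + a | a <- above k.+1 p & j <= a].
  rewrite /above filter_map -map_comp -filter_predI -[LHS]map_id.
  rewrite (@eq_filter _ _ (predI (fun a => j <= a - k.+1) (fun a => k.+1 < a))); last first.
    by move=> a /=; lia.
  by apply/eq_in_map => a; rewrite mem_filter /= => /andP[? _]; lia.
rewrite (@count_shift _ (fun a => a < j) k.+1) ?count_le_marked; last by move=> a; lia.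
have -> : count (fun b => k.+1 + j < b) p = count (fun b => j < b) (above k.+1 p).
  by rewrite count_above; apply: eq_count => b; lia.
congr [&& _, _ & _]; try lia.
by case: filter => //= a s; rewrite !(inj_eq Some_inj) eqn_add2l.
Qed.

Lemma count_critical_above :
  count (fun j => critical n j p) (iota k.+2 (n - k.+1)) = cm_classical (above k.+1 p).
Proof.
rewrite (cm_classicalE size_above_marked (letters_above k.+1 lp)).
rewrite -[k.+2]addn1 iotaDl count_map; apply: eq_in_count => j.
by rewrite mem_iota => /andP[j0 _]; rewrite /= -critical_above.
Qed.

End Marked.

End Maxima.

(** The factorisation of x^c - 1 by x - 1, with one power of [x] for each element satisfying [Q];
    its exponent counts the later such elements. *)
Lemma expr_count_telescope (R : comNzRingType) (x : R) (Q : pred nat) a n :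
  (x ^+ count Q (iota a n) - 1
   = (x - 1) * \sum_(k < n)
       (if Q (a + k)%N then x ^+ count Q (iota (a + k).+1 (n - k.+1)) else 0))%R.
Proof.
elim: n a => [|n IHn] a; first by rewrite big_ord0 mulr0 subrr.
rewrite big_ord_recl mulrDr.
under eq_bigr => k _ do rewrite lift0 -!addSnnS subSS.
rewrite -IHn [iota a _]/= [count Q (a :: _)]/= addn0 subn1 /=.
case: (Q a) => /=; last by rewrite mulr0 add0r.
by rewrite exprS; ring.
Qed.

(** * Recursions for parking functions *)

Section Decompositions.

Variable R : comNzRingType.
Implicit Types (m n k i N : nat) (p u v : seq nat) (x y z : R).

(** Every word has exactly one gap [k], with [k <= m < N], and avoids the letter [k + 1]; it is a
    shuffle of a classical parking function of length [k] and an arbitrary word on [N - k - 1]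
    letters. *)
Lemma wsum_gap m N (F : seq nat -> R) (G H : nat -> seq nat -> R) :
    (m < N)%N ->
    (forall k p, (k <= m)%N -> size p = m -> letters N p -> gap k p ->
       F p = G k (below k.+1 p) * H k (above k.+1 p)) ->
  wsum m N F =
  \sum_(k < m.+1)
     (wsum k k (fun u => if parking k u then G k u else 0)
      * wsum (m - k) (N - k.+1) (H k)) *+ 'C(m, k).
Proof.
move=> mN FGH.
transitivity (\sum_(k < m.+1) wsum m N (fun p => if gap k p then F p else 0)).
  rewrite -wsum_sum; apply: eq_wsum => p sp lp.
  have [k km gk] := gap_exists lp; rewrite sp -ltnS in km.
  rewrite (bigD1 (Ordinal km)) //= gk big1 ?addr0 // => j /eqP jk.
  case: ifP => // gj; case: jk; apply: val_inj => /=.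
  exact: gap_unique lp gj gk.
apply: eq_bigr => k _; have km := ltn_ord k.
(* The test on [size u] leaves only the term [i = k] of the shuffle. *)
pose K u v : R :=
  if (size u == k) && parking k u then G k u * H k v else 0.
have NE : N = (k + (N - k.+1).+1)%N by lia.
rewrite [in LHS]NE (@eq_wsum _ _ _ _
  (fun p => if k.+1 \in p then 0 else K (below k.+1 p) (above k.+1 p))).
  rewrite wsum_shuffle /shuffle (bigD1 k) //= [X in _ + X]big1 ?addr0.
    congr (_ *+ _); rewrite -wsumZr; apply: eq_wsum => u su lu.
    rewrite -wsumZ; apply: eq_wsum => v _ _; rewrite /K su eqxx /=.
    by case: ifP; rewrite ?mul0r.
  move=> i ik; rewrite (@eq_wsum _ _ _ _ (fun=> 0)) ?wsum0 ?mul0rn //.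
  move=> u su _; rewrite -[RHS](wsum0 R (m - i) (N - k.+1)).
  apply: eq_wsum => v _ _; rewrite /K su.
  by rewrite -val_eqE /= in ik; rewrite (negbTE ik).
move=> p sp; rewrite -NE => lp; rewrite /K; case: ifP => [gk|].
  have /and3P[/negbTE-> -> ->] := gk; rewrite (FGH k) //; lia.
rewrite /gap; case: (k.+1 \in p) => //= -> //.
Qed.

(** [pf1 y m] is P_m(1, y) and [pf x y m] is P_m(x, y); [pfn x y s m] sums over PF(m, m + s) and so
    belongs to [s + 1] parts in the theorem. *)
Definition pf1 y m : R :=
  wsum m m (fun p => if parking m p then y ^+ disp m p else 0).

Definition pf x y m : R :=
  wsum m m (fun p =>
    if parking m p then x ^+ cm_classical p * y ^+ disp m p else 0).

Definition pfn x y s m : R :=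
  wsum m (m + s) (fun p =>
    if parking (m + s) p then x ^+ cm (m + s) p * y ^+ disp (m + s) p else 0).

Lemma pfn0 x y m : pfn x y 0 m = pf x y m.
Proof.
rewrite /pfn addn0; apply: eq_wsum => p sp lp.
by case: ifP => // pp; rewrite cm_full.
Qed.

Lemma pfnS x y s m :
  pfn x y s.+1 m = \sum_(k < m.+1) (pf x y k * pfn x y s (m - k)) *+ 'C(m, k).
Proof.
rewrite /pfn (@wsum_gap _ _ _
  (fun k u => x ^+ cm_classical u * y ^+ disp k u)
  (fun k v => let n := (m + s.+1 - k.+1)%N in
     if parking n v then x ^+ cm n v * y ^+ disp n v else 0)).
- by apply: eq_bigr => k _; have -> : (m + s.+1 - k.+1 = m - k + s)%N by have := ltn_ord k; lia.
- by lia.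
move=> k p km sp lp gp /=; have kn : (k < m + s.+1)%N by lia.
rewrite -(parking_gap kn lp gp); case: ifP => [pp|]; last by rewrite mulr0.
by rewrite (cm_gap kn pp gp) (disp_gap kn pp gp) !exprD mulrACA.
Qed.

Lemma pf_rec x y m :
  pf x y m = pf1 y m
    + (x - 1) * \sum_(i < m) (pf1 y i * pf x y (m - i.+1)) *+ 'C(m, i).
Proof.
(* The term of the critical maximum [k + 1] in the telescoped power: [u] gets no power of [x], since
   only the later critical maxima, those of [v], are counted. *)
pose K k u v : R := if (size u == k) && parking k u then
    y ^+ disp k u * (if parking (m - k.+1) v then
      x ^+ cm_classical v * y ^+ disp (m - k.+1) v else 0) else 0.
transitivity (wsum m m (fun p => (if parking m p then y ^+ disp m p else 0) + (x - 1) *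
    \sum_(k < m) if marked k.+1 p then K k (below k.+1 p) (above k.+1 p) else 0)).
  apply: eq_wsum => p sp lp.
  have KE (k : 'I_m) : (if marked k.+1 p then K k (below k.+1 p) (above k.+1 p) else 0)
      = (if parking m p then y ^+ disp m p else 0)
        * (if critical m (1 + k) p
           then x ^+ count (fun j => critical m j p) (iota (1 + k).+1 (m - k.+1)) else 0).
    have km := ltn_ord k; rewrite criticalE // /K.
    case: ifP => [mp|_]; last by rewrite mulr0.
    case: eqP => [sb|_] /=; last by rewrite mulr0.
    rewrite (count_critical_above km sp lp mp sb).
    have := disp_marked km sp lp mp sb; rewrite (parking_marked km sp lp mp sb).
    case: (parking k _) => /=; last by rewrite mul0r.
    case: ifP => _; last by rewrite mulr0 mul0r.
    by move=> -> //; rewrite exprD [in RHS]mulrC mulrCA mulrA.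
  under eq_bigr => k _ do rewrite KE.
  rewrite -mulr_sumr mulrCA -expr_count_telescope -(cm_classicalE sp lp).
  by case: ifP => _; ring.
rewrite wsumD wsumZ wsum_sum; congr (_ + _ * _); apply: eq_bigr => k _.
have km := ltn_ord k; have mE : m = (k + (m - k.+1).+1)%N by lia.
rewrite [X in wsum m X]mE wsum_marked (bigD1 k) //= [X in _ + X]big1 ?addr0.
  congr (_ *+ _); rewrite -wsumZr; apply: eq_wsum => u su lu.
  have -> : (m.-1 - k = m - k.+1)%N by lia.
  rewrite /pf -wsumZ; apply: eq_wsum => v _ _; rewrite /K su eqxx /=.
  by case: ifP; rewrite ?mul0r.
move=> i ik; rewrite (@eq_wsum _ _ _ _ (fun=> 0)) ?wsum0 ?mul0rn // => u su _.
rewrite -[RHS](wsum0 R (m.-1 - i) (m - k.+1)); apply: eq_wsum => v _ _; rewrite /K su.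
by rewrite -val_eqE /= in ik; rewrite (negbTE ik).
Qed.

Lemma count_split_prod k p (w : nat -> R) : k \notin p ->
  \prod_(a <- p) w a
    = \prod_(a <- below k p) w a * \prod_(a <- above k p) w (k + a)%N.
Proof.
rewrite /above big_map !big_filter.
elim: p => [|a p IHp]; first by rewrite !big_nil mulr1.
rewrite inE negb_or !big_cons => /andP[ka /IHp ->].
case: (ltngtP a k) ka => //= ak _; first by rewrite mulrA.
by rewrite subnKC 1?ltnW // mulrCA.
Qed.

(** The total weight of the letters 1, ..., [r + 1], the last one weighing 1. *)
Lemma geometric_sum z r :
  \sum_(b < r) z * (1 + z) ^+ (r - b.+1) + 1 = (1 + z) ^+ r.
Proof.
elim: r => [|r IHr]; first by rewrite big_ord0 add0r.
rewrite big_ord_recl subn1 /= -addrA.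
have -> : \sum_(i < r) z * (1 + z) ^+ (r.+1 - (bump 0 i).+1)
    = \sum_(b < r) z * (1 + z) ^+ (r - b.+1) by [].
by rewrite IHr exprS; ring.
Qed.

Lemma prod_expr y n p : letters n p ->
  \prod_(a <- p) y ^+ (n - a) * y ^+ sumn p = y ^+ (n * size p).
Proof.
elim: p => [|a p IHp] /=; first by rewrite big_nil muln0 mulr1.
move=> /andP[an lp]; rewrite big_cons exprD mulrACA IHp // -!exprD.
by congr (_ ^+ _); lia.
Qed.

End Decompositions.

Lemma pf1_rec (R : idomainType) (z : R) n : 1 + z != 0 ->
  \sum_(k < n.+1) (z ^+ k * pf1 (1 + z) k * (1 + z) ^+ 'C(n - k, 2)) *+ 'C(n, k)
  = (1 + z) ^+ 'C(n.+1, 2).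
Proof.
set y := 1 + z => y0; have C2 j : ('C(j, 2) * 2 = j * j.-1)%N.
  by case: j => [|j] //; rewrite -[X in (_ * X)%N]/(2`!) bin_ffact ffactnS ffactn1.
(* Each of the [n] places has total weight [y ^+ n], so all words together weigh [y ^+ (n * n)];
   this factor completes the right-hand side to that power. *)
apply: (mulfI (expf_neq0 'C(n, 2) y0)); rewrite -exprD.
have -> : ('C(n, 2) + 'C(n.+1, 2) = n * n)%N.
  by have := C2 n; have := C2 n.+1; case: (n) => //= m; nia.
pose w a := if (a <= n)%N then z * y ^+ (n - a) else 1.
have <- : wsum n n.+1 (fun p => \prod_(a <- p) w a) = y ^+ (n * n).
  rewrite wsum_prod exprM; congr (_ ^+ _); rewrite big_ord_recr /= /w ltnn.
  rewrite -geometric_sum; congr (_ + _); apply: eq_bigr => b _.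
  by rewrite ltn_ord.
rewrite (@wsum_gap _ _ _ _ (fun k u => \prod_(a <- u) w a)
   (fun k v => \prod_(a <- v) w (k.+1 + a)%N)) //; last first.
  by move=> k p _ _ _ /and3P[kp _ _]; apply: count_split_prod.
rewrite mulr_sumr; apply: eq_bigr => -[k kn] _ /=; rewrite mulrnAr; congr (_ *+ _).
rewrite wsum_prod subSS.
(* The letters beyond [k + 1] have total weight [y ^+ (n - k.+1)]; for [k = n] none is left and both
   sides are empty powers. *)
have -> : (\sum_(a < n - k) w (k.+1 + a.+1)%N) ^+ (n - k) = y ^+ ((n - k.+1) * (n - k)).
  have [->|kn'] := eqVneq k n; first by rewrite subnn muln0 !expr0.
  rewrite exprM; congr (_ ^+ _); have -> : (n - k = (n - k.+1).+1)%N by lia.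
  rewrite big_ord_recr /= -geometric_sum; congr (_ + _).
    apply: eq_bigr => b _; have := ltn_ord b; rewrite /w => bn.
    have -> : (k.+1 + b.+1 <= n)%N by lia.
    by congr (_ * _ ^+ _); lia.
  by rewrite /w ifF //; lia.
(* The numbers [n - a] add up to n k - C(k+1, 2) + disp; the negative term is moved to the left, and
   the identity is multiplied by the same factor below. *)
have uE u : size u = k -> letters k u -> parking k u ->
   \prod_(a <- u) w a * y ^+ 'C(k.+1, 2) = z ^+ k * y ^+ disp k u * y ^+ (n * k).
  move=> su lu; rewrite -{1 2}su => pu.
  have ln : letters n u by apply: sub_all lu => a; lia.
  have -> : \prod_(a <- u) w a = z ^+ k * \prod_(a <- u) y ^+ (n - a).
    rewrite -{}su; elim: (u) ln => [|a s IHs] /=; first by rewrite !big_nil mulr1.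
    move=> /andP[/andP[_ an] /IHs e]; rewrite !big_cons e /w an exprS; ring.
  rewrite -disp_classical // exprD [y ^+ _ * y ^+ sumn _]mulrC mulrA -[_ * _ * y ^+ sumn _]mulrA.
  by rewrite prod_expr // su; ring.
apply: (mulIf (expf_neq0 'C(k.+1, 2) y0)).
rewrite [RHS]mulrAC -[in RHS]wsumZr.
rewrite (@eq_wsum _ _ _ _ (fun u =>
    z ^+ k * y ^+ (n * k) * (if parking k u then y ^+ disp k u else 0))).
  rewrite wsumZ -/(pf1 y k).
  transitivity (z ^+ k * pf1 y k * y ^+ ('C(n, 2) + 'C(n - k, 2) + 'C(k.+1, 2))).
    by rewrite exprD exprD; ring.
  transitivity (z ^+ k * pf1 y k * y ^+ (n * k + (n - k.+1) * (n - k))); last first.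
    by rewrite exprD; ring.
  congr (_ * _ ^+ _); have := C2 n; have := C2 (n - k)%N; have := C2 k.+1.
  rewrite ltnS in kn; rewrite -(subnKC kn); move: (n - k)%N => r; rewrite addKn.
  have -> : (k + r - k.+1 = r.-1)%N by lia.
  have -> : ((k + r) * (k + r).-1 = r * r.-1 + k * k + 2 * (r * k) - k)%N.
    by case: r => [|r]; rewrite ?addnS; nia.
  by case: r => [|r] /=; nia.
move=> u su lu; case: ifP => pu; last by rewrite mulr0 mul0r.
by rewrite uE // mulrAC.
Qed.

(** * Graph enumerators by the component of a vertex *)

Section Graphs.

Variable T : finType.
Implicit Types (u v w : T) (S V : {set T}) (A B : {set {set T}}).

(** Graphs on varying vertex sets [V] live in one type [T], so inductions pass to subsets without
    relabelling; [components] counts only the classes of vertices in [V]. *)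
Definition edges V : {set {set T}} := [set e : {set T} | e \subset V & #|e| == 2%N].

Definition component A v : {set T} := [set u | connect (adj A) v u].

Definition components A V : {set {set T}} := [set component A v | v in V].

Lemma adj_connect_sym A : connect_sym (adj A).
Proof. by apply: sym_connect_sym => u v; rewrite /adj /= setUC. Qed.

Lemma mem_comp A v : v \in component A v.
Proof. by rewrite inE connect0. Qed.

Lemma comp_eqP A u v : reflect (component A u = component A v) (u \in component A v).
Proof.
apply: (iffP idP) => [|<-]; last exact: mem_comp.
rewrite inE adj_connect_sym => uv; apply/setP => w; rewrite !inE.
exact: (same_connect (adj_connect_sym A)).
Qed.

Lemma sub_connect_in (e1 e2 : rel T) (a : {pred T}) u w :
    (forall x y, x \in a -> e1 x y -> e2 x y && (y \in a)) ->
  u \in a -> connect e1 u w -> connect e2 u w.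
Proof.
move=> sub ua /connectP[p + ->]; elim: p u ua => [|x p IHp] u ua //=.
move=> /andP[/(sub _ _ ua)/andP[ux xa] /(IHp _ xa)].
by apply: connect_trans; apply: connect1.
Qed.

Lemma edges_adj A V u w : A \subset edges V -> adj A u w -> (u \in V) && (w \in V).
Proof.
move=> /subsetP sub /sub; rewrite inE => /andP[/subsetP uwV _].
by rewrite !uwV ?set21 ?set22.
Qed.

Lemma comp_sub A V v : A \subset edges V -> v \in V -> component A v \subset V.
Proof.
move=> sub vV; apply/subsetP => w; rewrite inE => vw.
rewrite -(@closed_connect _ (adj A) (mem V) _ _ _ vw) //.
by apply: (intro_closed (adj_connect_sym A)) => x y /(edges_adj sub)/andP[].
Qed.

(** The ends of an edge lie in the same component, so both or neither are in [S]. *)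
Lemma edges_split A S V v e :
    A \subset edges V -> component A v = S -> e \in A ->
  (e \in edges S) || (e \in edges (V :\: S)).
Proof.
move=> sub vS eA; have := subsetP sub _ eA; rewrite !inE => /andP[eV e2].
rewrite e2 !andbT; case/cards2P: e2 eA eV => a [b [ab ->]] abA.
have abS : (a \in S) = (b \in S).
  rewrite -vS !inE; apply: (same_connect_r (adj_connect_sym A)).
  exact: connect1.
by rewrite !subUset !sub1set !inE abS; case: (b \in S).
Qed.

Lemma adjU A B u w : adj (A :|: B) u w = adj A u w || adj B u w.
Proof. by rewrite /adj /= inE. Qed.

Section Split.

Variables (A1 A2 : {set {set T}}) (S V : {set T}).
Hypotheses (sub1 : A1 \subset edges S) (sub2 : A2 \subset edges (V :\: S)).

Lemma comp_splitl v : v \in S -> component (A1 :|: A2) v = component A1 v.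
Proof.
move=> vS; apply/setP => w; rewrite !inE; apply/idP/idP.
  apply: (@sub_connect_in _ _ (mem S)) => // x y xS; rewrite adjU => /orP[xy|xy].
    by rewrite xy; case/andP: (edges_adj sub1 xy).
  by case/andP: (edges_adj sub2 xy); rewrite inE xS.
by apply: connect_sub => x y xy; apply: connect1; rewrite adjU xy.
Qed.

Lemma comp_splitr v : v \in V :\: S -> component (A1 :|: A2) v = component A2 v.
Proof.
move=> vS; apply/setP => w; rewrite !inE; apply/idP/idP.
  apply: (@sub_connect_in _ _ (mem (V :\: S))) => // x y xS; rewrite adjU => /orP[xy|xy].
    by case/andP: (edges_adj sub1 xy) => xS'; move: xS; rewrite !inE xS'.
  by rewrite xy; case/andP: (edges_adj sub2 xy).
by apply: connect_sub => x y xy; apply: connect1; rewrite adjU xy orbT.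
Qed.

Lemma comps_split v :
    S \subset V -> v \in S -> component A1 v = S ->
  #|components (A1 :|: A2) V| = #|components A2 (V :\: S)|.+1.
Proof.
move=> SV vS cS.
have -> : components (A1 :|: A2) V = S |: components A2 (V :\: S).
  apply/setP => C; rewrite in_setU1; apply/imsetP/orP => [[w wV ->]|[/eqP->|]].
  - have [wS|wS] := boolP (w \in S); [left|right].
      by rewrite comp_splitl // -cS; apply/eqP/comp_eqP; rewrite cS.
    have wVS : w \in V :\: S by rewrite inE wS.
    by rewrite comp_splitr // imset_f.
  - by exists v; rewrite ?(subsetP SV) // comp_splitl.
  - case/imsetP => w wVS ->; exists w; last by rewrite comp_splitr.
    by case/setDP: wVS.
rewrite cardsU1; suff -> : S \notin components A2 (V :\: S) by [].
apply/imsetP => -[w wVS] Sw; have := mem_comp A2 w; rewrite -Sw.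
by case/setDP: wVS => _ /negbTE->.
Qed.

End Split.

Variable R : comNzRingType.
Implicit Types (q z : R).

(** The random-cluster partition function of the complete graph on [V]. *)
Definition graph_sum z q V : R :=
  \sum_(A in powerset (edges V)) z ^+ #|A| * q ^+ #|components A V|.

Definition connected_sum z V v : R :=
  \sum_(A in powerset (edges V) | component A v == V) z ^+ #|A|.

(** [S] is the component of [v]: a graph consists of a connected graph on [S], which contributes one
    factor [q], and an arbitrary graph on the other vertices. *)
Lemma graph_sum_split z q V v :
    v \in V ->
  graph_sum z q V =
  \sum_(S : {set T} | (v \in S) && (S \subset V))
     connected_sum z S v * (q * graph_sum z q (V :\: S)).
Proof.
move=> vV; rewrite /graph_sum.
rewrite (partition_big (fun A => component A v) (fun S => (v \in S) && (S \subset V))) /=;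
  last first.
  by move=> A; rewrite inE mem_comp => /comp_sub; apply.
apply: eq_bigr => S /andP[vS SV].
rewrite /connected_sum mulr_sumr big_distrlr /= pair_big /=.
(* Graphs in which [v] has component [S] correspond to pairs of edge sets, by union and by
   restriction to either side. *)
rewrite (reindex_onto (fun B : {set {set T}} * {set {set T}} => B.1 :|: B.2)
  (fun A => (A :&: edges S, A :&: edges (V :\: S)))) /=; last first.
  move=> A; rewrite inE => /andP[sub /eqP vA].
  rewrite -setIUr; apply/setIidPl/subsetP => e eA.
  by rewrite inE; apply: edges_split vA eA.
have dE : edges S :&: edges (V :\: S) = set0.
  apply/setP => e; rewrite !inE; apply/negbTE/negP.
  case/andP => /andP[eS /cards2P[a [b [_ eab]]]] /andP[eVS _].
  move: eS eVS; rewrite eab !subUset !sub1set !inE => /andP[-> _].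
  by [].
apply: eq_big => [[B1 B2]|[B1 B2]] /=.
  apply/idP/idP.
    move=> /andP[/andP[sub /eqP vB] /eqP[e1 e2]].
    have sub1 : B1 \subset edges S by rewrite -e1 subsetIr.
    have sub2 : B2 \subset edges (V :\: S) by rewrite -e2 subsetIr.
    by rewrite !inE sub1 sub2 -(comp_splitl sub1 sub2 vS) vB eqxx.
  rewrite !inE => /andP[/andP[sub1 /eqP vB] sub2].
  rewrite (comp_splitl sub1 sub2 vS) vB eqxx andbT subUset.
  have eS (W : {set T}) : W \subset V -> edges W \subset edges V.
    move=> WV; apply/subsetP => e; rewrite !inE => /andP[eW ->].
    by rewrite (subset_trans eW).
  rewrite (subset_trans sub1 (eS _ SV)) (subset_trans sub2 (eS _ (subsetDl _ _))) /=.
  rewrite !setIUl (setIidPl sub1) (setIidPl sub2).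
  have -> : B2 :&: edges S = set0.
    by apply/eqP; rewrite -subset0 -dE setIC setIS.
  have -> : B1 :&: edges (V :\: S) = set0.
    by apply/eqP; rewrite -subset0 -dE setSI.
  by rewrite setU0 set0U eqxx.
move=> /andP[/andP[sub /eqP vB] /eqP[e1 e2]].
have sub1 : B1 \subset edges S by rewrite -e1 subsetIr.
have sub2 : B2 \subset edges (V :\: S) by rewrite -e2 subsetIr.
rewrite (comps_split sub1 sub2 SV vS); last by rewrite -(comp_splitl sub1 sub2 vS).
rewrite cardsU (_ : B1 :&: B2 = set0) ?cards0 ?subn0.
  by rewrite exprD exprS -mulrA; congr (_ * _); apply: mulrCA.
by apply/eqP; rewrite -subset0 -dE setISS.
Qed.

Lemma sum_by_card (f : nat -> R) V v n :
    v \in V -> #|V| = n.+1 ->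
  \sum_(S : {set T} | (v \in S) && (S \subset V)) f #|S|
  = \sum_(k < n.+1) f k.+1 *+ 'C(n, k).
Proof.
move=> vV cV; have cVv : #|V :\ v| = n by have := cardsD1 v V; rewrite vV cV; lia.
rewrite (reindex_onto (fun S => v |: S) (fun S => S :\ v)) /=; last first.
  by move=> S /andP[vS _]; rewrite setD1K.
rewrite (eq_bigl (fun S => S \subset V :\ v)) => [|S]; last first.
  rewrite setU11 subUset sub1set vV /= subsetD1; congr (_ && _).
  apply/eqP/idP => [<-|vS]; first by rewrite !inE eqxx.
  by rewrite setU1K.
(* [inord] loses nothing here, as the sets have at most [n] elements. *)
rewrite (partition_big (fun S : {set T} => inord #|S| : 'I_n.+1) xpredT) //=.
apply: eq_bigr => k _.
have -> : 'C(n, k) = #|[set S : {set T} | S \subset V :\ v & #|S| == k]|.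
  by rewrite cards_draws cVv.
rewrite -sumr_const.
apply: eq_big => [S|S /andP[SV /eqP Sk]]; rewrite ?inE.
  have [SV|//] := boolP (S \subset V :\ v); rewrite /= -val_eqE /= inordK //.
  by rewrite ltnS -cVv subset_leq_card.
have := subset_leq_card SV; rewrite cVv -ltnS => Sn.
have -> : #|v |: S| = k.+1; last by [].
rewrite cardsU1 -Sk inordK //.
by have := subsetP SV v; case: (v \in S) => // /(_ isT); rewrite !inE eqxx.
Qed.

Lemma graph_sum1 z V : graph_sum z 1 V = (1 + z) ^+ 'C(#|V|, 2).
Proof.
rewrite -cards_draws -/(edges V) exprDn; set E := edges V.
rewrite /graph_sum -/E (partition_big (fun A => inord #|A| : 'I_#|E|.+1) xpredT) //=.
apply: eq_bigr => k _; rewrite expr1n mul1r -cards_draws -sumr_const.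
apply: eq_big => [A|A /andP[AE /eqP Ak]]; rewrite ?inE.
  have [AE|//] := boolP (A \subset E); rewrite /= -val_eqE /= inordK //.
  by rewrite ltnS subset_leq_card.
rewrite inE in AE; rewrite expr1n mulr1 -Ak inordK // ltnS.
exact: subset_leq_card.
Qed.

End Graphs.

(** * Tutte polynomials of complete graphs *)

Section Forest.

Variable T : finType.
Implicit Types (u v w : T) (S V : {set T}) (A B : {set {set T}}).

(** A walk from [w] reaches neither [a] nor [b], so it cannot use the new edge. *)
Lemma comp_add_edge A a b w :
    component A w != component A a -> component A w != component A b ->
  component ([set a; b] |: A) w = component A w.
Proof.
move=> wa wb; apply/setP => x; rewrite !inE; apply/idP/idP; last first.
  by apply: connect_sub => u v uv; apply: connect1; rewrite adjU uv orbT.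
apply: (@sub_connect_in _ _ _ (mem (component A w))); last exact: mem_comp.
move=> u v uw; rewrite /adj /= in_setU1 => /orP[/eqP uv|uv]; last first.
  rewrite uv; move: uw; rewrite !inE => /connect_trans; apply; exact: connect1.
have : u \in [set a; b] by rewrite -uv set21.
move/comp_eqP: uw wa wb => <-; rewrite !inE.
by move=> wa wb /orP[] /eqP ue; rewrite ue eqxx in wa wb.
Qed.

(** Deleting an edge creates at most one new component. This bounds the rank by the number of edges,
    so the nullity in [tutte] is a true difference. *)
Lemma leq_edges_comps A V :
  A \subset edges V -> (#|V| <= #|A| + #|components A V|)%N.
Proof.
move: {2}#|A| (erefl #|A|) => m; elim: m A => [|m IHm] A cA sub.
  have -> : A = set0 by apply/eqP; rewrite -cards_eq0 cA.
  rewrite cards0 add0n card_in_imset // => u w _ _ uw.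
  have : w \in component set0 u by rewrite uw mem_comp.
  rewrite inE => /connectP[[|c p] //=]; rewrite /adj /= inE //.
have [e eA] : exists e, e \in A by apply/card_gt0P; rewrite cA.
have := subsetP sub _ eA; rewrite inE => /andP[eV /cards2P[a [b [_ eab]]]].
have sub' : A :\ e \subset edges V by rewrite (subset_trans _ sub) // subD1set.
have cA' : #|A :\ e| = m by have := cardsD1 e A; rewrite eA cA => -[].
have := IHm _ cA' sub'; rewrite cA' cA; set A' := A :\ e => IH.
have AE : A = [set a; b] |: A' by rewrite -eab setD1K.
have aV : a \in V by apply: (subsetP eV); rewrite eab set21.
have := cardsD1 (component A a) (components A V); rewrite imset_f // add1n => cE.
(* The components that contain neither end of the deleted edge are unchanged by it and differ from
   the merged one. *)
have : components A' V :\: [set component A' a; component A' b] \subset components A V :\ component A a.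
  apply/subsetP => C /setDP[/imsetP[w wV ->]].
  rewrite !inE negb_or => /andP[wa wb].
  have cw : component A w = component A' w by rewrite AE comp_add_edge.
  rewrite -cw imset_f // andbT cw; apply: contra wa => /eqP wa.
  by apply/eqP/esym/comp_eqP; rewrite wa mem_comp.
move/subset_leq_card; rewrite cardsD.
have := subset_leq_card (subsetIr (components A' V) [set component A' a; component A' b]).
have : (#|[set component A' a; component A' b]| <= 2)%N by rewrite cards2; case: (_ != _).
rewrite cE; move: IH; move: #|V| #|components A' V| #|components A V :\ _|.
move: #|_ :&: _| #|[set component A' a; component A' b]| => i s c c' k.
lia.
Qed.

Lemma n_comp_comps A : n_comp (adj A) T = #|components A [set: T]|.
Proof.
have sA := adj_connect_sym A; rewrite /n_comp_mem.
have -> : components A [set: T] = (component A) @: [set v | roots (adj A) v].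
  apply/setP => C; apply/imsetP/imsetP => -[v vr ->].
    exists (fingraph.root (adj A) v); first by rewrite inE roots_root.
    by apply/esym/comp_eqP; rewrite inE connect_root.
  by exists v.
rewrite card_in_imset => [|u v]; last first.
  rewrite !inE => ur vr /esym/comp_eqP; rewrite inE => /(fingraph.rootP sA).
  by rewrite (eqP ur) (eqP vr).
by apply: eq_card => v; rewrite !inE andbT.
Qed.

Lemma comps_complete v : #|components (edges [set: T]) [set: T]| = 1%N.
Proof.
have cE u : component (edges [set: T]) u = [set: T].
  apply/setP => w; rewrite !inE; have [->|uw] := eqVneq u w; first exact: connect0.
  by apply: connect1; rewrite /adj /= inE subsetT cards2 uw.
rewrite (_ : components _ _ = [set [set: T]]) ?cards1 //.
apply/setP => C; rewrite in_set1; apply/imsetP/eqP => [[u _ ->]|->]; first exact: cE.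
by exists v; rewrite ?cE.
Qed.

End Forest.

Section Evaluation.

Variables (R : idomainType) (z : R).
Hypothesis y0 : 1 + z != 0.

(** Splitting all graphs by the component of [v] gives the recursion [pf1_rec]; by induction the
    terms with [S] proper agree, which leaves the term [S = V]. *)
Lemma connected_sumE (T : finType) (V : {set T}) v n :
    v \in V -> #|V| = n.+1 ->
  connected_sum z V v = z ^+ n * pf1 (1 + z) n.
Proof.
elim/ltn_ind: n V => n IHn V vV cV.
pose g c : R := z ^+ c.-1 * pf1 (1 + z) c.-1 * (1 + z) ^+ 'C(n.+1 - c, 2).
have : graph_sum z 1 V = \sum_(S : {set T} | (v \in S) && (S \subset V)) g #|S|.
  by rewrite (sum_by_card g vV cV) graph_sum1 cV -pf1_rec //.
rewrite (graph_sum_split z 1 vV) (bigD1 V) ?vV //= [RHS](bigD1 V) ?vV //=.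
set X := \sum_(i | _) _; set Y := \sum_(i | _) _.
have -> : X = Y.
  apply: eq_bigr => S /andP[/andP[vS SV] neS].
  have lt : (#|S| < #|V|)%N by rewrite proper_card // properEneq neS.
  have S1 : (0 < #|S|)%N by apply/card_gt0P; exists v.
  rewrite (IHn #|S|.-1 _ S) ?prednK //; last by rewrite cV in lt; lia.
  rewrite mul1r graph_sum1 /g cardsD (setIidPr SV) cV; congr (_ * _).
move/addIr; rewrite setDv mul1r graph_sum1 cards0 /g cV subnn bin0n /= !expr0 !mulr1.
by [].
Qed.

Lemma graph_sum0 (T : finType) (q : R) : graph_sum z q (set0 : {set T}) = 1.
Proof.
rewrite /graph_sum (_ : edges set0 = set0) ?powerset0 ?big_set1.
  by rewrite cards0 /components imset0 cards0 mulr1.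
apply/setP => e; rewrite !inE subset0; apply/negbTE/negP => /andP[/eqP->].
by rewrite cards0.
Qed.

(** In the split by the component [S] of a vertex, [S = V] yields the [pf1] term of [pf_rec] and the
    proper [S] yield its sum. *)
Lemma graph_sumE (T : finType) (x : R) (V : {set T}) n :
    #|V| = n.+1 ->
  graph_sum z ((x - 1) * z) V = (x - 1) * z ^+ n.+1 * pf x (1 + z) n.
Proof.
elim/ltn_ind: n V => n IHn V cV.
have [v vV] : exists v, v \in V by apply/card_gt0P; rewrite cV.
(* The expected value on [c] vertices; without vertices there is only the empty graph, with no
   component, whence 1. *)
pose h c : R := if c is c'.+1 then (x - 1) * z ^+ c * pf x (1 + z) c' else 1.
pose g c : R := z ^+ c.-1 * pf1 (1 + z) c.-1 * ((x - 1) * z * h (n.+1 - c)%N).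
transitivity (\sum_(S : {set T} | (v \in S) && (S \subset V)) g #|S|).
  rewrite (graph_sum_split z _ vV); apply: eq_bigr => S /andP[vS SV].
  have S1 : (0 < #|S|)%N by apply/card_gt0P; exists v.
  rewrite (connected_sumE (n := #|S|.-1) vS) ?prednK //; congr (_ * (_ * _)).
  have : #|V :\: S| = (n.+1 - #|S|)%N by rewrite cardsD (setIidPr SV) cV.
  case: (n.+1 - #|S|)%N (leq_subr 1 #|S|) => [|k] _.
    by move/eqP; rewrite cards_eq0 => /eqP->; rewrite graph_sum0.
  move=> cVS; rewrite (IHn k) //.
  have := subset_leq_card SV; have := cardsD V S; rewrite (setIidPr SV) cVS cV; lia.
rewrite (sum_by_card g vV cV) big_ord_recr /= binn mulr1n /g subnn /= mulr1.
rewrite pf_rec mulrDr addrC; congr (_ + _); first by rewrite exprS; ring.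
rewrite !mulr_sumr; apply: eq_bigr => k _; rewrite -!mulrnAr.
have kn := ltn_ord k; rewrite !mulrnAr; congr (_ *+ _).
have -> : (n.+1 - k.+1 = (n - k.+1).+1)%N by lia.
rewrite /h; have -> : (z ^+ n.+1 = z ^+ k * z * z ^+ (n - k.+1).+1).
  by rewrite -exprSr -exprD; congr (_ ^+ _); lia.
by move: (pf1 _ _) (pf _ _ _) (z ^+ k) (z ^+ _.+1) => a b c d; ring.
Qed.

End Evaluation.

Section Tutte.

Let x : {mpoly int[2]} := 'X_0.
Let y : {mpoly int[2]} := 'X_1.

Lemma mpolyX_sub1_neq0 (i : 'I_2) : ('X_i - 1 : {mpoly int[2]}) != 0.
Proof.
apply/eqP => /(congr1 (mpoly.meval (fun=> 0))).
by rewrite rmorphB rmorph1 /= mpoly.mevalXU rmorph0 sub0r => /eqP.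
Qed.

(** A graph with c components has rank N + 1 - c, so the exponents in [tutte] are c - 1 and |A| - (N
    + 1) + c; the prefactor turns them into c and |A| + c. *)
Lemma tutte_graph_sum N :
  (x - 1) * (y - 1) ^+ N.+1 * tutte_complete N.+1
  = graph_sum (y - 1) ((x - 1) * (y - 1)) [set: 'I_N.+1].
Proof.
have E : complete_edges N.+1 = edges [set: 'I_N.+1].
  by apply/setP => e; rewrite !inE subsetT.
rewrite /tutte_complete /tutte /graph_sum E mulr_sumr; apply: eq_bigr => A; rewrite inE => sub.
have := leq_edges_comps sub; rewrite /rank_edges !n_comp_comps (comps_complete ord0).
rewrite cardsT card_ord => fA.
have c1 : (0 < #|components A [set: 'I_N.+1]|)%N.
  by apply/card_gt0P; exists (component A ord0); apply: imset_f.
have c2 : (#|components A [set: 'I_N.+1]| <= N.+1)%N.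
  by rewrite -[X in (_ <= X)%N]card_ord -cardsT leq_imset_card.
move: fA c1 c2; move: #|components _ _| => c; move: #|A| => a fA c1 c2.
transitivity ((x - 1) ^+ (1 + (N.+1 - 1 - (N.+1 - c))) * (y - 1) ^+ (N.+1 + (a - (N.+1 - c)))).
  by rewrite !exprD expr1 -!/x -!/y; ring.
rewrite exprMn mulrCA -exprD; congr (_ ^+ _ * _ ^+ _); lia.
Qed.

Lemma tutte_complete_pf m : tutte_complete m.+1 = pf x y m.
Proof.
have z0 : y - 1 != 0 := mpolyX_sub1_neq0 1.
have x0 : x - 1 != 0 := mpolyX_sub1_neq0 0.
have y1 : 1 + (y - 1) = y by rewrite addrCA subrr addr0.
apply: (mulfI (mulf_neq0 x0 (expf_neq0 m.+1 z0))).
rewrite tutte_graph_sum (@graph_sumE _ _ _ _ _ _ m) ?cardsT ?card_ord ?y1 //.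
(* What remains is the side condition that [y] is nonzero, seen by evaluating at 1. *)
apply/eqP => /(congr1 (mpoly.meval (fun=> 1))).
by rewrite mpoly.mevalXU rmorph0 => /eqP; rewrite oner_eq0.
Qed.

End Tutte.

(** * Multinomial sums *)

Lemma prod_fact_dvd s (x : 'I_s -> nat) m :
  (\sum_(i < s) x i)%N = m -> (\prod_(i < s) (x i)`! %| m`!)%N.
Proof.
elim: s x m => [|s IHs] x m; first by rewrite !big_ord0 dvd1n.
rewrite !big_ord_recl => xm.
have le : (x ord0 <= m)%N by rewrite -xm leq_addr.
rewrite -(bin_fact le) mulnCA dvdn_pmul2l ?fact_gt0 // dvdn_mull //.
by apply: IHs; rewrite -xm addKn.
Qed.

Lemma multinomialS s (x : 'I_s.+1 -> nat) m :
    (\sum_(i < s.+1) x i)%N = m ->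
  multinomial m x
  = ('C(m, x ord0) * multinomial (m - x ord0) (fun i => x (lift ord0 i)))%N.
Proof.
rewrite big_ord_recl => xm; have le : (x ord0 <= m)%N by rewrite -xm leq_addr.
rewrite /multinomial big_ord_recl -(bin_fact le) muln_divA; last first.
  by apply: prod_fact_dvd; rewrite -xm addKn.
by rewrite mulnCA divnMl ?fact_gt0.
Qed.

(* The parts are bounded by a fixed [M], which keeps the index type constant in the induction. *)
Lemma multinomial_sum_rec (R : comNzRingType) (t : nat -> R) s m M :
    (m <= M)%N ->
  \sum_(x : {ffun 'I_s.+1 -> 'I_M.+1} | (\sum_(i < s.+1) (x i : nat) == m)%N)
     (multinomial m (fun i => x i : nat))%:R * \prod_(i < s.+1) t (x i)
  = \sum_(k < m.+1) (t k *
     \sum_(x : {ffun 'I_s -> 'I_M.+1} | (\sum_(i < s) (x i : nat) == m - k)%N)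
       (multinomial (m - k) (fun i => x i : nat))%:R * \prod_(i < s) t (x i))
       *+ 'C(m, k).
Proof.
move=> mM.
rewrite (partition_big (fun x : {ffun 'I_s.+1 -> 'I_M.+1} => inord (x ord0) : 'I_m.+1) xpredT) //=.
apply: eq_bigr => k _; rewrite mulr_sumr -sumrMnl.
have km := ltn_ord k.
(* [inord k] really is [k], because [k <= m <= M]. *)
pose cons (x : {ffun 'I_s -> 'I_M.+1}) : {ffun 'I_s.+1 -> 'I_M.+1} :=
  [ffun i => if unlift ord0 i is Some j then x j else inord k].
pose tail (x : {ffun 'I_s.+1 -> 'I_M.+1}) : {ffun 'I_s -> 'I_M.+1} :=
  [ffun j => x (lift ord0 j)].
have cons0 x : cons x ord0 = k :> nat by rewrite ffunE unlift_none inordK //; lia.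
have consS x i : cons x (lift ord0 i) = x i by rewrite ffunE liftK.
rewrite (reindex_onto cons tail) /=; last first.
  move=> x /andP[/eqP xm /eqP xk]; apply/ffunP => i; rewrite ffunE.
  case: unliftP => [j ->|->]; first by rewrite ffunE.
  have le : (x ord0 <= m)%N by rewrite -xm big_ord_recl leq_addr.
  by apply: val_inj; rewrite /= -xk !inordK //; lia.
apply: eq_big => [x|x].
  have -> : tail (cons x) = x by apply/ffunP => i; rewrite ffunE consS.
  rewrite eqxx andbT big_ord_recl cons0.
  rewrite (eq_bigr (fun i => x i : nat)) => [|i _]; last by rewrite consS.
  have -> : inord k = k by apply: val_inj; rewrite /= inordK.
  by rewrite eqxx andbT -(eqn_add2l k (\sum_(i < s) x i)) (subnKC (ltnSE km)).
move=> /andP[/andP[/eqP xm _] _].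
rewrite multinomialS // cons0 big_ord_recl cons0 natrM.
under [\prod_(i < s) _]eq_bigr => i _ do rewrite consS.
have -> : multinomial (m - k) (fun i => cons x (lift ord0 i) : nat)
        = multinomial (m - k) (fun i => x i : nat).
  by rewrite /multinomial; congr (_ %/ _)%N; apply: eq_bigr => i _; rewrite consS.
by rewrite -mulrA mulr_natl mulrCA.
Qed.

Lemma multinomial_sum_pfn (R : comNzRingType) (x y : R) s m M :
    (m <= M)%N ->
  \sum_(f : {ffun 'I_s.+1 -> 'I_M.+1} | (\sum_(i < s.+1) (f i : nat) == m)%N)
     (multinomial m (fun i => f i : nat))%:R * \prod_(i < s.+1) pf x y (f i)
  = pfn x y s m.
Proof.
elim: s m => [|s IHs] m mM.
  (* With a single part, the empty sum of the other parts equals [m - k] only for [k = m]. *)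
  rewrite multinomial_sum_rec // pfn0 big_ord_recr /= [X in X + _]big1 ?add0r => [|k _].
    rewrite binn mulr1n subnn (big_pred1 [ffun i : 'I_0 => ord0]).
      by rewrite /multinomial !big_ord0 divn1 mulr1 mulr1.
    by move=> f; rewrite big_ord0 eqxx; apply/esym/eqP/ffunP => -[].
  rewrite big_pred0 ?mulr0 ?mul0rn // => f; rewrite big_ord0; have := ltn_ord k; lia.
rewrite multinomial_sum_rec // pfnS; apply: eq_bigr => k _.
by rewrite IHs // (leq_trans (leq_subr _ _)).
Qed.

Theorem theorem2p6 (s m : nat) (hs : (0 < s)%N) :
  \sum_(x : {ffun 'I_s -> 'I_m.+1} | (\sum_(i < s) (x i : nat) == m)%N)
     (multinomial m (fun i : 'I_s => x i : nat))%:R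
     * \prod_(i < s) tutte_complete (x i).+1
  = \sum_(p in PF m (m + s - 1))
     ('X_0 : {mpoly int[2]}) ^+ cm (m + s - 1) (map val p)
     * ('X_1 : {mpoly int[2]}) ^+ disp (m + s - 1) (map val p).
Proof.
case: s hs => // s _; rewrite addnS subn1 /=.
under eq_bigr => f _ do under eq_bigr => i _ do rewrite tutte_complete_pf.
(* A word containing 0 is not parking, as [wsum_tuple] requires. *)
rewrite multinomial_sum_pfn // /pfn -wsum_tuple => [|p p0]; last first.
  by rewrite ifF //; apply/negbTE/negP => /parking_letters/allP/(_ _ p0).
by rewrite [RHS]big_mkcond; apply: eq_bigr => p _; rewrite inE.
Qed.
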